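(* Let $\gamma = (\gamma_{\mathfrak{u}})$ be weights (non-negative real numbers) indexed by the non-empty finite subsets $\mathfrak{u}$ of $\mathbb{N}=\{1,2,\dots\}$. Assume that for some constant $c>0$ the weights satisfy $\gamma_{\mathfrak{u}} \leq c\, |\mathfrak{u}|^{-1/2}$ for all $\mathfrak{u}$, and $$ \sum_{\mathfrak{u}} e^{-c \gamma_{\mathfrak{u}}^{-2}} < \infty , $$ where the sum is over all non-empty finite $\mathfrak{u}\subset\mathbb{N}$. Then there exists a constant $C_\gamma$ such that for any $N \geq 1$ and $d \geq 1$ there exist points $x_1, \dots, x_N \in [0,1]^d$ for which $$ D_{N,\gamma}^* (x_1, \dots, x_N) \leq \frac{C_\gamma}{\sqrt{N}}. $$ Consequently, the weighted star-discrepancy for such weights is strongly tractable with $\varepsilon$-exponent at most $2$.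
   Context: $|\mathfrak{u}|$ denotes the cardinality of $\mathfrak{u}$. The term $e^{-c\gamma_{\mathfrak{u}}^{-2}}$ is read as $0$ when $\gamma_{\mathfrak{u}}=0$. Points in a point set $x_1,\dots,x_N$ are counted with multiplicity. For $x_1,\dots,x_N\in[0,1]^d$ and $z=(z_1,\dots,z_d)\in[0,1]^d$, the discrepancy function is $$\Delta(z)=\frac1N\sum_{n=1}^N \mathbf{1}_{[0,z)}(x_n)-\lambda([0,z)),$$ where $[0,z)=\prod_{i=1}^d[0,z_i)$ and $\lambda$ is $d$-dimensional Lebesgue measure. For a non-empty subset $\mathfrak{u}\subset\{1,\dots,d\}$, $(z(\mathfrak{u});1)$ denotes the point of $[0,1]^d$ obtained from $z$ by replacing every coordinate whose index is not in $\mathfrak{u}$ by $1$. The weighted star-discrepancy is $$D_{N,\gamma}^*(x_1,\dots,x_N)=\sup_{z\in[0,1]^d}\ \max_{\emptyset\ne\mathfrak{u}\subset\{1,\dots,d\}}\gamma_{\mathfrak{u}}\,|\Delta(z(\mathfrak{u});1)|.$$ $n_\gamma^*(d,\varepsilon)$ denotes the smallest possible cardinality of a set of points from $[0,1]^d$ whose weighted star-discrepancy with respect to $\gamma$ is at most $\varepsilon$. The weighted star-discrepancy (for given weights $\gamma$) is called strongly tractable if there exist non-negative constants $C,\beta$ such that $n_\gamma^*(d,\varepsilon)\le C\varepsilon^{-\beta}$ for all $d\ge1$ and $\varepsilon\in(0,1)$; in that case the infimum of the $\beta$ for which this holds (with some $C$) is called the $\varepsilon$-exponent of strong tractability. *)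

(* Defs.v *)
From HB Require Import structures.
From mathcomp Require Export all_boot all_order all_algebra finmap.
From mathcomp Require Export all_classical all_reals all_analysis.
Import Order.TTheory GRing.Theory Num.Theory.

Set Implicit Arguments.
Unset Strict Implicit.
Unset Printing Implicit Defensive.

Local Open Scope classical_set_scope.
Local Open Scope ring_scope.

(* Coordinates are numbered from 0: the index set {1, ..., d} is 'I_d, the
   finite subsets of {1, 2, ...} are the elements of {fset nat}, and weights
   are a function on {fset nat} whose value at the empty set is never used. *)

Section Defs.
Context {R : realType}.

(* The d-dimensional Lebesgue measure, as the d-fold iteration of the product
   measure \x of lebesgue_measure, i.e. the measure of A is the integral of
   the measures of its sections (meaningful for measurable A). *)
Fixpoint lebesgue_tuple (d : nat) : set (d.-tuple R) -> \bar R :=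
  match d with
  | 0 => fun A => (\1_A [tuple])%:E
  | n.+1 => fun A =>
      (\int[@lebesgue_measure R]_t
         lebesgue_tuple [set s : n.-tuple R | A [tuple of t :: s]])%E
  end.

Definition unit_cube (d : nat) : set (d.-tuple R) :=
  [set z | forall i : 'I_d, 0 <= tnth z i <= 1].

Definition anchored_box (d : nat) (z : d.-tuple R) : set (d.-tuple R) :=
  [set t | forall i : 'I_d, 0 <= tnth t i < tnth z i].

Definition discrepancy (d N : nat) (x : N.-tuple (d.-tuple R))
    (z : d.-tuple R) : R :=
  N%:R^-1 * (\sum_(n < N) \1_(anchored_box z) (tnth x n))
  - fine (lebesgue_tuple (anchored_box z)).

Definition replace1 (d : nat) (u : {set 'I_d}) (z : d.-tuple R) : d.-tuple R :=
  [tuple if i \in u then tnth z i else 1 | i < d].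

Definition fset_of_coords (d : nat) (u : {set 'I_d}) : {fset nat} :=
  [fset val i | i in u]%fset.

(* The starting value 0 of the maximum is harmless: it ranges over a non-empty
   family of non-negative numbers as soon as d >= 1 and the weights are
   non-negative. *)
Definition weighted_star_discrepancy (gamma : {fset nat} -> R) (d N : nat)
    (x : N.-tuple (d.-tuple R)) : \bar R :=
  ereal_sup
    [set (\big[Num.max/0]_(u : {set 'I_d} | (0 < #|u|)%N)
            (gamma (fset_of_coords u)
             * `|discrepancy x (replace1 u z)|))%:E | z in @unit_cube d].

(* A point set is a tuple of points, so points count with multiplicity. *)
Definition points_in_cube (d N : nat) (x : N.-tuple (d.-tuple R)) : Prop :=
  forall n : 'I_N, unit_cube (tnth x n).

(* The least N, or +oo if there is none. *)
Definition n_star (gamma : {fset nat} -> R) (d : nat) (eps : R) : \bar R :=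
  ereal_inf
    [set (N%:R)%:E | N in
       [set N : nat | (0 < N)%N /\
          exists x : N.-tuple (d.-tuple R), points_in_cube x /\
            (weighted_star_discrepancy gamma x <= eps%:E)%E]].

Definition tractability_bound (gamma : {fset nat} -> R) (C beta : R) : Prop :=
  forall (d : nat) (eps : R), (1 <= d)%N -> 0 < eps < 1 ->
    (n_star gamma d eps <= (C * eps `^ (- beta))%:E)%E.

Definition tractability_exponents (gamma : {fset nat} -> R) : set R :=
  [set beta | 0 <= beta /\
     exists C : R, 0 <= C /\ tractability_bound gamma C beta].

Definition strongly_tractable (gamma : {fset nat} -> R) : Prop :=
  exists C beta : R,
    [/\ 0 <= C, 0 <= beta & tractability_bound gamma C beta].

Definition strong_tractability_exponent (gamma : {fset nat} -> R) : R :=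
  inf (tractability_exponents gamma).

(* exp (- c g^-2), with the value 0 at g = 0. *)
Definition exp_inv_sq (c g : R) : R :=
  if g == 0 then 0 else expR (- (c * g ^- 2)).

End Defs.

(* Main.v *)
(** Random points on the grid [{0, ..., M - 1}^d / M] with [M = 2 d N] work with
positive probability: every box has almost the same mass for the uniform
distribution on the grid as for Lebesgue measure, so only finite counting
measures occur.  For a set [u] of [k] coordinates, rounding the side lengths of
a box to powers of [1 - 1 / (2 k 2^m)] brackets it up to measure [2^-m] with
only [exp(O(k (m + 1)))] brackets, because the exponents of the boxes that are
not negligible have bounded sum.  Chaining along these brackets with
Bernstein's inequality bounds by [4 exp(- t^2)] the probability that the
deviation for [u] exceeds [O(t / sqrt N)], provided [t^2 >= k].  With
[t = B / gamma_u] the hypothesis on the cardinality of [u] gives [t^2 >= k], and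
summability gives total failure probability less than 1 for [B] large. *)
Require Import Defs.
From mathcomp Require Import ring lra zify.
Import Order.TTheory GRing.Theory Num.Theory.

Set Implicit Arguments.
Unset Strict Implicit.
Unset Printing Implicit Defensive.

Local Open Scope ring_scope.

(** * Bernstein's inequality for the uniform distribution *)

(** Unnormalised: [N] times the gap between the empirical mean of [f] and its mean for the uniform
    distribution on [T]. A sample is a function [w], so probabilities are cardinalities divided by
    [#|T| ^ N]. *)
Definition deviation (R : realType) (T : finType) (N : nat)
    (w : {ffun 'I_N -> T}) (f : T -> R) : R :=
  \sum_n f (w n) - N%:R * (#|T|%:R^-1 * \sum_x f x).

(** Since [expR (- y) >= 1 - y], it suffices that [(1 + y + 2 y^2) (1 - y) = 1 + y^2 (1 - 2 y)] is
    at least 1. *)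
Lemma expR_le_quadratic (R : realType) (y : R) :
  y <= 2^-1 -> expR y <= 1 + y + 2 * y ^+ 2.
Proof.
move=> hy.
have h1 : 1 - y <= expR (- y) by rewrite expR_ge1Dx.
have h2 : expR y * expR (- y) = 1 by rewrite -expRD subrr expR0.
have h3 := expR_gt0 y.
have h4 : expR y * (1 - y) <= 1 by rewrite -[leRHS]h2 ler_wpM2l // ltW.
have h5 : 1 <= (1 + y + 2 * y ^+ 2) * (1 - y).
  have : 0 <= y ^+ 2 * (1 - 2 * y) by rewrite mulr_ge0 ?sqr_ge0 //; lra.
  lra.
have h6 : 0 < 1 - y by lra.
by rewrite -(ler_pM2r h6); lra.
Qed.

(** Chernoff's method: Markov's inequality for [expR (l * deviation)], whose sum over samples
    factorises. The restriction [a <= N v] keeps the optimal [l] small enough for the quadratic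
    bound on [expR]. *)
Lemma bernstein_upper (R : realType) (T : finType) (N : nat) (f : T -> R)
    (v a : R) :
  (0 < N)%N -> 0 < v -> (forall x, `|f x| <= 1) ->
  \sum_x f x ^+ 2 <= v * #|T|%:R -> 0 <= a <= N%:R * v ->
  #|[set w : {ffun 'I_N -> T} | a <= deviation w f]|%:R
    <= expR (- (a ^+ 2 / (8 * N%:R * v))) * #|T|%:R ^+ N.
Proof.
move=> N_gt0 v_gt0 f_le1 f_sq /andP[a_ge0 a_le].
have [T0|T_gt0] := posnP #|T|.
  rewrite T0 expr0n gtn_eqF //= mulr0.
  rewrite (_ : #|_| = 0)%N //; apply: eq_card0 => w; exfalso.
  by have := fintype0 (w (Ordinal N_gt0)) T0.
have T_gt0R : 0 < #|T|%:R :> R by rewrite ltr0n.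
have N_gt0R : 0 < N%:R :> R by rewrite ltr0n.
pose e := #|T|%:R^-1 * \sum_x f x.
have eE : #|T|%:R * e = \sum_x f x by rewrite /e mulVKf // gt_eqF.
(* This minimises [2 N v l^2 - l a]. As [|f - e| <= 2], the bound [l <= 1/4] gives
   [l (f - e) <= 1/2]. *)
pose l := a / (4 * N%:R * v).
have D_gt0 : 0 < 4 * N%:R * v by rewrite !mulr_gt0.
have l_ge0 : 0 <= l by rewrite divr_ge0 // ltW.
have l_le : l <= 4^-1.
  by rewrite /l ler_pdivrMr //; lra.
have e_le1 : `|e| <= 1.
  rewrite /e normrM normfV normr_nat [leLHS]mulrC ler_pdivrMr // mul1r.
  apply: le_trans (ler_norm_sum _ _ _) _.
  by apply: le_trans (ler_sum _ (fun x _ => f_le1 x)) _; rewrite sumr_const.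
(* The linear terms cancel after centring, and the variance is at most the second moment. *)
have mgf : \sum_x expR (l * (f x - e)) <= #|T|%:R * expR (2 * l ^+ 2 * v).
  have h x : expR (l * (f x - e)) <= 1 + (l * (f x - e)) + 2 * (l * (f x - e)) ^+ 2.
    apply: expR_le_quadratic; have := f_le1 x; move: e_le1; rewrite !ler_norml.
    by move=> /andP[? ?] /andP[? ?]; nra.
  apply: le_trans (ler_sum _ (fun x _ => h x)) _.
  have -> : \sum_x (1 + (l * (f x - e)) + 2 * (l * (f x - e)) ^+ 2) =
     #|T|%:R * (1 - l * e + 2 * l ^+ 2 * e ^+ 2) + (l - 4 * l ^+ 2 * e) * (\sum_x f x)
     + 2 * l ^+ 2 * \sum_x f x ^+ 2.
    rewrite !mulr_sumr mulr_natl -sumr_const -!big_split /=.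
    by apply: eq_bigr => x _; ring.
  rewrite -eE.
  have := expR_ge1Dx (2 * l ^+ 2 * v); set E := expR _ => hE.
  have h7 : 2 * l ^+ 2 * (\sum_x f x ^+ 2) <= 2 * l ^+ 2 * (v * #|T|%:R).
    by apply: ler_wpM2l => //; rewrite mulr_ge0 // sqr_ge0.
  have h8 : (1 + 2 * l ^+ 2 * v) * #|T|%:R <= E * #|T|%:R by rewrite ler_wpM2r // ltW.
  have h9 : 0 <= (l * e) ^+ 2 * #|T|%:R by rewrite mulr_ge0 ?sqr_ge0 // ltW.
  by nra.
have markov : #|[set w : {ffun 'I_N -> T} | a <= deviation w f]|%:R * expR (l * a)
    <= \sum_(w : {ffun 'I_N -> T}) expR (l * deviation w f).
  rewrite -sum1_card natr_sum mulr_suml.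
  rewrite [X in _ <= X](bigID (fun w => w \in [set w : {ffun 'I_N -> T} | a <= deviation w f])) /=.
  rewrite -[X in X <= _]addr0; apply: lerD; last first.
    by apply: sumr_ge0 => w _; exact: expR_ge0.
  apply: ler_sum => w; rewrite inE mul1r ler_expR => aw.
  by rewrite ler_wpM2l.
have prodE : \sum_(w : {ffun 'I_N -> T}) expR (l * deviation w f) =
   (\sum_x expR (l * (f x - e))) ^+ N.
  transitivity (\prod_(n < N) \sum_x expR (l * (f x - e))); last first.
    by rewrite prodr_const card_ord.
  rewrite bigA_distr_bigA /=; apply: eq_bigr => w _.
  rewrite -expR_sum; congr expR.
  by rewrite -mulr_sumr sumrB sumr_const card_ord /deviation -/e mulr_natl.
have key : #|[set w : {ffun 'I_N -> T} | a <= deviation w f]|%:R * expR (l * a)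
    <= (#|T|%:R * expR (2 * l ^+ 2 * v)) ^+ N.
  apply: le_trans markov _; rewrite prodE.
  by rewrite lerXn2r // nnegrE ?sumr_ge0 // ?mulr_ge0 ?expR_ge0 ?ler0n.
move: key; rewrite exprMn -expRM_natl => key.
have -> : - (a ^+ 2 / (8 * N%:R * v)) = 2 * l ^+ 2 * v * N%:R - l * a.
  by rewrite /l; field; rewrite !gt_eqF.
rewrite expRD expRN mulrAC ler_pdivlMr ?expR_gt0 //.
by apply: le_trans key _; rewrite mulrC [N%:R * _]mulrC.
Qed.

Lemma deviationN (R : realType) (T : finType) (N : nat)
    (w : {ffun 'I_N -> T}) (f : T -> R) :
  deviation w (fun x => - f x) = - deviation w f.
Proof. by rewrite /deviation !sumrN; ring. Qed.

Lemma deviationB (R : realType) (T : finType) (N : nat)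
    (w : {ffun 'I_N -> T}) (f g : T -> R) :
  deviation w (fun x => f x - g x) = deviation w f - deviation w g.
Proof. by rewrite /deviation !sumrB; ring. Qed.

Lemma bernstein (R : realType) (T : finType) (N : nat) (f : T -> R) (v a : R) :
  (0 < N)%N -> 0 < v -> (forall x, `|f x| <= 1) ->
  \sum_x f x ^+ 2 <= v * #|T|%:R -> 0 <= a <= N%:R * v ->
  #|[set w : {ffun 'I_N -> T} | a <= `|deviation w f|]|%:R
    <= 2 * expR (- (a ^+ 2 / (8 * N%:R * v))) * #|T|%:R ^+ N.
Proof.
move=> N_gt0 v_gt0 f_le1 f_sq ha.
have h1 := bernstein_upper N_gt0 v_gt0 f_le1 f_sq ha.
have h2 : #|[set w : {ffun 'I_N -> T} | a <= deviation w (fun x => - f x)]|%:R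
    <= expR (- (a ^+ 2 / (8 * N%:R * v))) * #|T|%:R ^+ N.
  apply: bernstein_upper => // [x|]; first by rewrite normrN.
  by under eq_bigr do rewrite sqrrN.
rewrite -mulrA [2 * _]mulr_natl mulr2n.
apply: le_trans (lerD h1 h2); rewrite -natrD ler_nat.
apply: leq_trans (leq_card_setU _ _); apply: subset_leq_card.
apply/fintype.subsetP => w; rewrite !inE deviationN => {h1 h2 ha}.
by rewrite ler_normr.
Qed.

Definition set_deviation (R : realType) (T : finType) (N : nat)
    (w : {ffun 'I_N -> T}) (A : {set T}) : R :=
  deviation w (fun x => (x \in A)%:R).

Lemma natr_card (R : pzSemiRingType) (T : finType) (A : {set T}) :
  #|A|%:R = \sum_x (x \in A)%:R :> R.
Proof. by rewrite -natr_sum -big_mkcond sum1_card. Qed.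

Lemma set_deviationE (R : realType) (T : finType) (N : nat)
    (w : {ffun 'I_N -> T}) (A : {set T}) :
  set_deviation R w A
    = \sum_n (w n \in A)%:R - N%:R * (#|A|%:R / #|T|%:R).
Proof.
rewrite /set_deviation /deviation; congr (_ - _ * _).
by rewrite mulrC -natr_card.
Qed.

(** The difference of two indicators is bounded by 1, and its square is the indicator of the
    symmetric difference, whose measure therefore serves as the variance bound. *)
Lemma bernstein_set (R : realType) (T : finType) (N : nat) (A B : {set T})
    (v a : R) :
  (0 < N)%N -> 0 < v ->
  #|A :\: B|%:R + #|B :\: A|%:R <= v * #|T|%:R -> 0 <= a <= N%:R * v ->
  #|[set w : {ffun 'I_N -> T} |
       a <= `|set_deviation R w A - set_deviation R w B|]|%:R
    <= 2 * expR (- (a ^+ 2 / (8 * N%:R * v))) * #|T|%:R ^+ N.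
Proof.
move=> N_gt0 v_gt0 dAB ha.
have := @bernstein R T N (fun x => (x \in A)%:R - (x \in B)%:R) v a N_gt0 v_gt0.
under eq_finset do rewrite deviationB.
apply => //.
  by move=> x; case: (x \in A); case: (x \in B);
    rewrite ?subrr ?subr0 ?sub0r ?normrN ?normr0 ?normr1.
apply: le_trans dAB; rewrite !natr_card -big_split /=.
apply: ler_sum => x _; rewrite !inE.
by case: (x \in A); case: (x \in B) => /=; lra.
Qed.

(** * Union bound over the levels *)

Lemma card_bigcup_le (I S : finType) (P : pred I) (F : I -> {set S}) :
  (#|\bigcup_(i | P i) F i| <= \sum_(i | P i) #|F i|)%N.
Proof.
elim/big_rec2: _ => [|i m A _ h]; first by rewrite cards0.
by apply: leq_trans (leq_card_setU _ _) _; rewrite leq_add2l.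
Qed.

Lemma expX_bernoulli (R : realType) (x : R) (n : nat) :
  -1 <= x -> 1 + n%:R * x <= (1 + x) ^+ n.
Proof.
move=> x_ge; elim: n => [|n IH]; first by rewrite mul0r addr0.
have x1_ge0 : 0 <= 1 + x by lra.
rewrite exprS -natr1; apply: le_trans (ler_wpM2l x1_ge0 IH).
have : 0 <= n%:R * x ^+ 2 by rewrite mulr_ge0 ?sqr_ge0.
by lra.
Qed.

Lemma expRN_le_half_exp (R : realType) (n : nat) : expR (- n%:R) <= 2^-1 ^+ n :> R.
Proof.
rewrite -mulN1r expRM_natr lerXn2r ?nnegrE ?expR_ge0 ?invr_ge0 //.
rewrite expRN lef_pV2 ?posrE ?expR_gt0 //.
by have := expR_ge1Dx (1 : R); lra.
Qed.

Lemma sum_geometric_half (R : realType) (n : nat) :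
  \sum_(m < n) (2^-1 : R) ^+ m <= 2.
Proof.
suff -> : \sum_(m < n) (2^-1 : R) ^+ m = 2 * (1 - 2^-1 ^+ n).
  by have : 0 <= (2^-1 : R) ^+ n by []; lra.
elim: n => [|n IH]; first by rewrite big_ord0 expr0 subrr mulr0.
by rewrite big_ord_recr /= IH exprS; lra.
Qed.

Lemma sum_geometric_three_quarters (R : realType) (n : nat) :
  \sum_(m < n) (3 / 4 : R) ^+ m <= 4.
Proof.
suff -> : \sum_(m < n) (3 / 4 : R) ^+ m = 4 * (1 - (3 / 4) ^+ n).
  by have : 0 <= (3 / 4 : R) ^+ n by []; lra.
elim: n => [|n IH]; first by rewrite big_ord0 expr0 subrr mulr0.
by rewrite big_ord_recr /= IH exprS; lra.
Qed.

(* The threshold [320 t (3/4)^m] is summable over the levels, while its square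
   divided by the variance bound [320 / 2^m] grows like [t^2 (9/8)^m] and so
   beats the number of pairs.  The inflated variance bound keeps the deviations
   in the Gaussian range. *)
Lemma union_bernstein (R : realType) (T : finType) (N n : nat)
    (E : nat -> {set {set T} * {set T}}) (t : R) :
  (0 < N)%N -> 1 <= t -> t * 2 ^+ n <= Num.sqrt N%:R ->
  (forall m, (m <= n)%N -> #|E m|%:R <= expR (t ^+ 2 * (8 + 4 * m%:R))) ->
  (forall m p, (m <= n)%N -> p \in E m ->
     (#|p.1 :\: p.2|%:R + #|p.2 :\: p.1|%:R) * 2 ^+ m <= 320 * #|T|%:R :> R) ->
  #|[set w : {ffun 'I_N -> T} | [exists m : 'I_n.+1, exists p in E m,
       320 * t * (3 / 4) ^+ m * Num.sqrt N%:R
         <= `|set_deviation R w p.1 - set_deviation R w p.2|]]|%:R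
    <= 4 * expR (- t ^+ 2) * #|T|%:R ^+ N.
Proof.
move=> N_gt0 t_ge1 tn cardE sizeE.
set s := Num.sqrt N%:R in tn *.
have s_gt0 : 0 < s by rewrite sqrtr_gt0 ltr0n.
have sE : N%:R = s ^+ 2 by rewrite sqr_sqrtr.
pose F m p := [set w : {ffun 'I_N -> T} | 320 * t * (3 / 4) ^+ m * s
         <= `|set_deviation R w p.1 - set_deviation R w p.2|].
have TN_ge0 : 0 <= #|T|%:R ^+ N :> R by rewrite exprn_ge0.
(* Bernstein's exponent is [40 t^2 (9/8)^m], which Bernoulli's inequality bounds below by
   [t^2 (40 + 5 m)]. The condition [t 2^n <= sqrt N] puts the threshold in the admissible range. *)
have F_le m p : (m <= n)%N -> p \in E m ->
    #|F m p|%:R <= 2 * expR (- (t ^+ 2 * (40 + 5 * m%:R))) * #|T|%:R ^+ N.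
  move=> mn pE; have p2_gt0 : 0 < 2 ^+ m :> R by [].
  have tm : t * 2 ^+ m <= s.
    apply: le_trans tn; rewrite ler_wpM2l ?ler_weXn2l //; lra.
  have q_ge0 : 0 <= (3 / 4 : R) ^+ m by [].
  have q_le1 : (3 / 4 : R) ^+ m <= 1 by rewrite exprn_ile1 //; lra.
  apply: (le_trans (@bernstein_set R T N p.1 p.2 (320 / 2 ^+ m) _ N_gt0 _ _ _)).
  - by rewrite divr_gt0.
  - by rewrite mulrAC ler_pdivlMr //; exact: sizeE.
  - apply/andP; split; first by rewrite !mulr_ge0 ?ltW //; lra.
    rewrite mulrA ler_pdivlMr // sE.
    have : (3 / 4 : R) ^+ m * (t * 2 ^+ m) <= 1 * s.
      by apply: ler_pM => //; rewrite mulr_ge0 //; lra.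
    move=> h; have := ler_wpM2l (ltW s_gt0) h; lra.
  rewrite ler_wpM2r // ler_wpM2l // ler_expR lerN2.
  have -> : (320 * t * (3 / 4) ^+ m * s) ^+ 2 / (8 * N%:R * (320 / 2 ^+ m))
     = 40 * t ^+ 2 * (1 + 8^-1) ^+ m.
    have -> : (1 + 8^-1) ^+ m = ((3 / 4 : R) ^+ m) ^+ 2 * 2 ^+ m.
      by rewrite exprAC -exprMn; congr (_ ^+ _); lra.
    by rewrite sE; field; rewrite !gt_eqF.
  have h : 1 + m%:R * 8^-1 <= (1 + 8^-1 : R) ^+ m.
    by apply: expX_bernoulli; lra.
  have : 0 <= 40 * t ^+ 2 by rewrite mulr_ge0 ?sqr_ge0.
  by move=> h0; have := ler_wpM2l h0 h; lra.
(* Multiplying by the number of pairs leaves [expR (- t^2 (32 + m))]; since [t >= 1], this is at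
   most [expR (- t^2) / 2^m]. *)
have level_le m : (m <= n)%N -> \sum_(p in E m) #|F m p|%:R
    <= 2 * expR (- t ^+ 2) * #|T|%:R ^+ N * 2^-1 ^+ m :> R.
  move=> mn.
  apply: le_trans (ler_sum _ (fun p pE => F_le m p mn pE)) _.
  rewrite sumr_const -[leLHS]mulr_natl.
  have h1 : #|E m|%:R * expR (- (t ^+ 2 * (40 + 5 * m%:R)))
     <= expR (- t ^+ 2) * 2^-1 ^+ m.
    apply: le_trans (ler_wpM2r (expR_ge0 _) (cardE m mn)) _.
    apply: le_trans (ler_wpM2l (expR_ge0 _) (expRN_le_half_exp R m)).
    rewrite -!expRD ler_expR.
    have h : 1 <= t ^+ 2 by rewrite expr_ge1 //; lra.
    have : 1 * m%:R <= t ^+ 2 * m%:R by rewrite ler_wpM2r.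
    lra.
  have := ler_wpM2r TN_ge0 h1; lra.
have sub : [set w : {ffun 'I_N -> T} | [exists m : 'I_n.+1, exists p in E m,
       320 * t * (3 / 4) ^+ m * s
         <= `|set_deviation R w p.1 - set_deviation R w p.2|]]
   \subset \bigcup_(m : 'I_n.+1) \bigcup_(p in E m) F m p.
  apply/fintype.subsetP => w; rewrite inE => /existsP[m /existsP[p pw]]; case/andP: pw => pE h.
  apply/finset.bigcupP; exists m => //; apply/finset.bigcupP; exists p => //.
  by rewrite inE.
have := subset_leq_card sub; rewrite -(ler_nat R) => /le_trans; apply.
apply: (@le_trans _ _ (\sum_(m < n.+1) \sum_(p in E m) #|F m p|%:R)).
  under [leRHS]eq_bigr do rewrite -natr_sum.
  rewrite -natr_sum ler_nat; apply: leq_trans (card_bigcup_le _ _) _.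
  by apply: leq_sum => m _; exact: card_bigcup_le.
apply: le_trans (ler_sum _ (fun (m : 'I_n.+1) _ => level_le m (ltn_ord m))) _.
rewrite -mulr_sumr.
have := sum_geometric_half R n.+1; set G := \sum_(_ < _) _ => hG.
have : 0 <= 2 * expR (- t ^+ 2) * #|T|%:R ^+ N by rewrite mulr_ge0 // mulr_ge0 ?expR_ge0.
by move=> h0; have := ler_wpM2l h0 hG; lra.
Qed.

(** * Chaining along brackets *)

Definition bracketing (R : realType) (T : finType) (sets : {set {set T}})
    (delta : R) (brackets : {set {set T} * {set T}}) : Prop :=
  (forall A, A \in sets -> exists2 b, b \in brackets &
     (b.1 \subset A) && (A \subset b.2)) /\
  (forall b, b \in brackets ->
     (b.1 \subset b.2) && (#|b.2 :\: b.1|%:R <= delta * #|T|%:R)).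

Lemma set_deviation_mono (R : realType) (T : finType) (N : nat)
    (w : {ffun 'I_N -> T}) (A B : {set T}) :
  A \subset B -> set_deviation R w A
    <= set_deviation R w B + N%:R * (#|B :\: A|%:R / #|T|%:R).
Proof.
move=> AB; rewrite !set_deviationE.
have h : \sum_n (w n \in A)%:R <= \sum_n (w n \in B)%:R :> R.
  by apply: ler_sum => n _; have := fintype.subsetP AB (w n);
    case: (w n \in A) => [->//|_]; case: (_ \in B).
have := cardsID A B; rewrite (finset.setIidPr AB) => <-.
by rewrite natrD; lra.
Qed.

(** Counts and measures are monotone, so the deviation of [A] is sandwiched between those of [L] and
    [U] up to [N delta]; that of [U] is reached from [L]. *)
Lemma set_deviation_bracket (R : realType) (T : finType) (N : nat)
    (w : {ffun 'I_N -> T}) (L A U : {set T}) (delta : R) :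
  (0 < #|T|)%N ->
  L \subset A -> A \subset U -> #|U :\: L|%:R <= delta * #|T|%:R ->
  `|set_deviation R w A| <= `|set_deviation R w L|
     + `|set_deviation R w U - set_deviation R w L| + N%:R * delta.
Proof.
move=> T_gt0 LA AU hd.
have le_delta (C : {set T}) : C \subset U :\: L ->
    N%:R * (#|C|%:R / #|T|%:R) <= N%:R * delta :> R.
  move=> /subset_leq_card CUL; rewrite ler_wpM2l // ler_pdivrMr ?ltr0n //.
  by apply: le_trans hd; rewrite ler_nat.
have := le_delta (U :\: A); rewrite finset.setDS // => /(_ isT).
have := le_delta (A :\: L); rewrite finset.setSD // => /(_ isT).
have := set_deviation_mono R w AU; have := set_deviation_mono R w LA.
have := ler_norm (set_deviation R w L).
have := ler_norm (- set_deviation R w L); rewrite normrN.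
have := ler_norm (set_deviation R w U - set_deviation R w L).
have := normr_ge0 (set_deviation R w U - set_deviation R w L).
by move=> *; rewrite ler_norml; apply/andP; split; lra.
Qed.

(** The deviation of [A] telescopes along the lower ends of its brackets at levels 0 to [n], and the
    gap of the last bracket closes the chain. The links cost at most [320 * 4] by the geometric
    series and the size of the last bracket costs 2, whence 1282. *)
Lemma chaining (R : realType) (T : finType) (sets : {set {set T}}) (N n : nat)
    (B : nat -> {set {set T} * {set T}}) (t : R) :
  (0 < N)%N -> (0 < #|T|)%N -> 1 <= t ->
  t * 2 ^+ n <= Num.sqrt N%:R -> Num.sqrt N%:R <= t * 2 ^+ n.+1 ->
  (forall m, (m <= n)%N -> bracketing sets (2^-1 ^+ m : R) (B m)) ->
  (forall m, (m <= n)%N -> #|B m|%:R <= expR (t ^+ 2 * (3 + 2 * m%:R))) ->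
  #|[set w : {ffun 'I_N -> T} | [exists A in sets,
       1282 * t * Num.sqrt N%:R < `|set_deviation R w A|]]|%:R
    <= 4 * expR (- t ^+ 2) * #|T|%:R ^+ N.
Proof.
move=> N_gt0 T_gt0 t_ge1 tn nt brB cardB.
(* With the trivial bracket at level 0 the chain starts from the empty set,
   whose deviation is 0. *)
pose D m := if m == 0 then [set (finset.set0, [set: T])%SET] else B m.
have brD m : (m <= n)%N -> bracketing sets (2^-1 ^+ m : R) (D m).
  case: m => [_|m mn]; last exact: brB.
  split=> [A _|b]; rewrite /D /=.
    by exists (finset.set0, [set: T]%SET); rewrite ?inE // finset.sub0set finset.subsetT.
  by rewrite inE => /eqP ->; rewrite finset.sub0set finset.setD0 cardsT mul1r lexx.
have cardD m : (m <= n)%N -> #|D m|%:R <= expR (t ^+ 2 * (3 + 2 * m%:R)).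
  case: m => [_|m mn]; last exact: cardB.
  rewrite /D /= cards1; apply: le_trans (expR_ge1Dx _).
  by rewrite lerDl mulr_ge0 ?sqr_ge0 //; lra.
pose linked (p : ({set T} * {set T}) * ({set T} * {set T})) :=
  [exists A in sets, [&& p.1.1 \subset A, A \subset p.1.2,
     p.2.1 \subset A & A \subset p.2.2]].
(* Below level [n]: lower ends of consecutive brackets around a common set. At level [n]: the two
   ends of one bracket. *)
pose E m := if (m < n)%N
  then [set (p.2.1, p.1.1) | p in [set p in finset.setX (D m) (D m.+1) | linked p]]
  else [set (b.2, b.1) | b in D m].
set s := Num.sqrt N%:R in tn nt *.
have s_ge0 : 0 <= s by exact: sqrtr_ge0.
have sE : N%:R = s ^+ 2 by rewrite sqr_sqrtr.
(* The exponents of two consecutive levels add up: [(3 + 2 m) + (3 + 2 (m + 1)) = 8 + 4 m]. *)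
have cardE m : (m <= n)%N -> #|E m|%:R <= expR (t ^+ 2 * (8 + 4 * m%:R)).
  move=> mn; have t2_ge0 := sqr_ge0 t; rewrite /E; case: ifP => mn1.
    apply: (@le_trans _ _ (#|D m| * #|D m.+1|)%:R).
      rewrite ler_nat; apply: leq_trans (leq_imset_card _ _) _.
      rewrite -cardsX; apply: subset_leq_card.
      by apply/fintype.subsetP => p; rewrite inE => /andP[].
    rewrite natrM; apply: le_trans (ler_pM _ _ (cardD m mn) (cardD m.+1 mn1)) _ => //.
    by rewrite -expRD ler_expR -natr1; lra.
  apply: (@le_trans _ _ (#|D m|)%:R); first by rewrite ler_nat leq_imset_card.
  apply: le_trans (cardD m mn) _; rewrite ler_expR ler_wpM2l //.
  by have := ler0n R m; lra.
(* Both lower ends lie in a common set [A], hence in both upper ends, so each difference of lower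
   ends lies in the gap of one of the two brackets. *)
have sizeE m p : (m <= n)%N -> p \in E m ->
    (#|p.1 :\: p.2|%:R + #|p.2 :\: p.1|%:R) * 2 ^+ m <= 320 * #|T|%:R :> R.
  move=> mn pE; have T_ge0 : 0 <= #|T|%:R :> R by [].
  have p2_gt0 : 0 < 2 ^+ m :> R by [].
  have le_level (X C : {set T}) (m' : nat) : (m <= m')%N -> X \subset C ->
      #|C|%:R <= 2^-1 ^+ m' * #|T|%:R :> R -> #|X|%:R * 2 ^+ m <= #|T|%:R :> R.
    move=> mm' /subset_leq_card XC hC.
    have : #|X|%:R <= 2^-1 ^+ m * #|T|%:R :> R.
      apply: (@le_trans _ _ #|C|%:R); first by rewrite ler_nat.
      apply: le_trans hC _; rewrite ler_wpM2r // ler_wiXn2l //; lra.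
    by move=> /(ler_wpM2r (ltW p2_gt0)); rewrite mulrAC -exprMn mulVf // expr1n mul1r.
  move: pE; rewrite /E; case: ifP => mn1 /imsetP[q].
    rewrite !inE => /andP[/andP[q1 q2] /existsP[A]] /and5P[_ q11 q12 q21 q22] -> /=.
    have /andP[_ h1] := (brD m mn).2 _ q1.
    have /andP[_ h2] := (brD m.+1 mn1).2 _ q2.
    have := le_level (q.2.1 :\: q.1.1) _ _ (leqnn m) _ h1.
    rewrite finset.setSD ?(fintype.subset_trans q21) // => /(_ isT).
    have := le_level (q.1.1 :\: q.2.1) _ _ (leqnSn m) _ h2.
    rewrite finset.setSD ?(fintype.subset_trans q11) // => /(_ isT).
    lra.
  move=> bD -> /=; have /andP[b12 h] := (brD m mn).2 _ bD.
  have := le_level (q.2 :\: q.1) _ _ (leqnn m) _ h => /(_ (fintype.subxx _)).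
  move: b12; rewrite -finset.setD_eq0 => /eqP ->; rewrite cards0 addr0; lra.
have := @union_bernstein R T N n E t N_gt0 t_ge1 tn cardE sizeE.
apply: le_trans; rewrite ler_nat; apply: subset_leq_card.
apply/fintype.subsetP => w; rewrite !inE; apply: contraLR => nE.
have small m p : (m <= n)%N -> p \in E m ->
    `|set_deviation R w p.1 - set_deviation R w p.2| <= 320 * t * (3 / 4) ^+ m * s.
  move=> mn pE; rewrite leNgt; apply: contra nE => /ltW h.
  by apply/existsP; exists (inord m); apply/existsP; exists p; rewrite inordK ?ltnS // pE.
have dev_level m A b : (m <= n)%N -> A \in sets -> b \in D m ->
    b.1 \subset A -> A \subset b.2 ->
    `|set_deviation R w b.1| <= 320 * t * s * \sum_(j < m) (3 / 4) ^+ j.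
  move=> + As; elim: m b => [|m IH] b mn bD b1 b2.
    move: bD; rewrite inE => /eqP -> /=; rewrite set_deviationE.
    rewrite cards0 mul0r mulr0 subr0 big1 ?normr0; last by move=> i _; rewrite inE.
    by rewrite big_ord0 mulr0.
  have [b' b'D /andP[b'1 b'2]] := (brD m (ltnW mn)).1 _ As.
  have := IH b' (ltnW mn) b'D b'1 b'2.
  have step : (b.1, b'.1) \in E m.
    rewrite /E mn; apply/imsetP; exists (b', b) => //.
    rewrite !inE b'D bD /=; apply/existsP; exists A.
    by rewrite As b'1 b'2 b1 b2.
  have := small m _ (ltnW mn) step; rewrite /= big_ord_recr /=.
  have := ler_normD (set_deviation R w b.1 - set_deviation R w b'.1) (set_deviation R w b'.1).
  by rewrite subrK; lra.
rewrite negb_exists; apply/forallP => A; rewrite negb_and -leNgt.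
case As: (A \in sets) => //=.
have [b bD /andP[b1 b2]] := (brD n (leqnn n)).1 _ As.
have /andP[b12 bsize] := (brD n (leqnn n)).2 _ bD.
have h1 := set_deviation_bracket w T_gt0 b1 b2 bsize.
have h2 := dev_level n A b (leqnn n) As bD b1 b2.
have h3 : `|set_deviation R w b.2 - set_deviation R w b.1| <= 320 * t * (3 / 4) ^+ n * s.
  by apply: (small n (b.2, b.1)) => //; rewrite /E ltnn; apply/imsetP; exists b.
(* The bound [sqrt N <= t 2^(n+1)] means that the chain is long enough for the last bracket to be
   negligible. *)
have h4 : N%:R * 2^-1 ^+ n <= 2 * t * s.
  rewrite sE exprVn ler_pdivrMr ?exprn_gt0 //.
  by have := ler_wpM2l s_ge0 nt; rewrite exprS; lra.
have := sum_geometric_three_quarters R n.+1; rewrite big_ord_recr /= => h5.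
have ts_ge0 : 0 <= 320 * t * s by rewrite !mulr_ge0 //; lra.
have := ler_wpM2l ts_ge0 h5; lra.
Qed.

(** * Brackets for boxes on a grid *)

(** Serves to lower the exponents of a negligible box until their sum is exactly the cut-off. *)
Lemma exists_sum_eq (I : finType) (f : I -> nat) (s : nat) :
  (s <= \sum_i f i)%N ->
  exists2 g : I -> nat, (forall i, (g i <= f i)%N) & (\sum_i g i = s)%N.
Proof.
elim: s => [|s IH] hs.
  by exists (fun=> 0%N) => //; rewrite big1.
have [g gf gs] := IH (ltnW hs).
have [i gi] : exists i, (g i < f i)%N.
  apply/existsP; apply: contraTT hs; rewrite negb_exists => /forallP h.
  by rewrite -leqNgt -gs; apply: leq_sum => i _; rewrite leqNgt.
exists (fun j => (g j + (j == i))%N) => [j|].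
  by case: eqP => [->|_]; rewrite ?addn1 ?addn0.
rewrite big_split /= gs -addn1; congr (_ + _)%N.
by rewrite (bigD1 i) //= eqxx big1 // => j /negPf ->.
Qed.

(** Induction on [x X - y Y = x (X - Y) + (x - y) Y], where [x] and [Y] are at most 1. *)
Lemma prod_sub_bound (R : realType) (I : finType) (P : pred I) (x y : I -> R) :
  (forall i, P i -> [/\ 0 <= y i, y i <= x i & x i <= 1]) ->
  0 <= \prod_(i | P i) x i - \prod_(i | P i) y i
    <= \sum_(i | P i) (x i - y i).
Proof.
move=> h.
suff : [/\ 0 <= \prod_(i | P i) y i, \prod_(i | P i) y i <= \prod_(i | P i) x i,
    \prod_(i | P i) x i <= 1 & \prod_(i | P i) x i - \prod_(i | P i) y i
    <= \sum_(i | P i) (x i - y i)].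
  by case=> *; apply/andP; split; lra.
elim/big_rec3: _ => [|i s X Y Pi [Y_ge0 YX X_le1 IH]]; first by split=> //; lra.
have [yi xyi xi] := h i Pi.
split; [exact: mulr_ge0|exact: ler_pM| |].
  by apply: mulr_ile1 => //; lra.
have h1 : x i * (X - Y) <= 1 * (X - Y) by rewrite ler_wpM2r //; lra.
have h2 : (x i - y i) * Y <= (x i - y i) * 1 by rewrite ler_wpM2l //; lra.
by lra.
Qed.

Definition grid_box (d M : nat) (u : {set 'I_d}) (a : 'I_d -> nat) :
    {set {ffun 'I_d -> 'I_M}} :=
  [set x : {ffun 'I_d -> 'I_M} | [forall i in u, (x i < a i)%N]].

Lemma grid_box_subset (d M : nat) (u : {set 'I_d}) (a b : 'I_d -> nat) :
  (forall i, i \in u -> (a i <= b i)%N) ->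
  grid_box M u a \subset grid_box M u b.
Proof.
move=> ab; apply/fintype.subsetP => x; rewrite !inE => /forall_inP xa.
by apply/forall_inP => i iu; apply: leq_trans (xa i iu) (ab i iu).
Qed.

(** The indicator of the box is a product of one-coordinate indicators, so its sum over the grid is
    a product of sums; a coordinate outside [u] gives [M / M = 1]. *)
Lemma measure_grid_box (R : realType) (d M : nat) (u : {set 'I_d})
    (a : 'I_d -> nat) :
  (0 < M)%N -> (forall i, i \in u -> (a i <= M)%N) ->
  #|grid_box M u a|%:R / #|{ffun 'I_d -> 'I_M}|%:R
    = \prod_(i in u) ((a i)%:R / M%:R) :> R.
Proof.
move=> M_gt0 aM.
have M_neq0 : M%:R != 0 :> R by rewrite pnatr_eq0 -lt0n.
pose F i (j : 'I_M) : R := ((i \in u) ==> (j < a i))%N%:R.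
have -> : #|grid_box M u a|%:R = \prod_i \sum_j F i j.
  rewrite bigA_distr_bigA natr_card /=; apply: eq_bigr => x _.
  rewrite inE; case: (boolP [forall i in u, (x i < a i)%N]).
    move=> /forall_inP h; rewrite big1 // => i _.
    by rewrite /F; case: (boolP (i \in u)) => //= /h ->.
  rewrite negb_forall => /existsP[i hi]; rewrite (bigD1 i) //= /F.
  by rewrite (negPf hi) mul0r.
rewrite card_ffun !card_ord natrX -[d in X in _ / X]card_ord -prodr_const -prodf_div.
rewrite [RHS]big_mkcond; apply: eq_bigr => i _; rewrite /F.
case: ifP => iu /=; last first.
  by rewrite sumr_const card_ord divff.
congr (_ / _); rewrite -natr_sum -big_mkcond (big_ord_narrow (aM i iu)) /=.
by rewrite sum_nat_const muln1 card_ord.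
Qed.

(* On the left each [n] contributes [x ^+ S], at most its term [x ^+ \sum_i n i]
   in the expansion of a product of geometric sums. *)
Lemma card_bounded_sum_le (R : realType) (d S : nat) (u : {set 'I_d}) (x : R) :
  0 <= x < 1 ->
  #|[set n : {ffun 'I_d -> 'I_S.+1} | (\sum_i n i <= S)%N
      && [forall i, (i \notin u) ==> (n i == ord0)]]|%:R * x ^+ S
    <= (1 - x)^-1 ^+ #|u|.
Proof.
move=> /andP[x_ge0 x_lt1]; set G := [set _ | _].
pose F i (j : 'I_S.+1) : R := if i \in u then x ^+ j else (j == ord0)%:R.
have F_ge0 i j : 0 <= F i j by rewrite /F; case: ifP; rewrite ?exprn_ge0.
have geom n : \sum_(j < n) x ^+ j <= (1 - x)^-1.
  rewrite -[(1 - x)^-1]mul1r ler_pdivlMr ?subr_gt0 //.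
  have := subrX1 x n; have := exprn_ge0 n x_ge0; lra.
apply: (@le_trans _ _ (\sum_(n in G) \prod_i F i (n i))).
  rewrite -sum1_card natr_sum mulr_suml; apply: ler_sum => n.
  rewrite inE => /andP[nS /forallP n0]; rewrite mul1r.
  apply: (@le_trans _ _ (x ^+ (\sum_i n i))).
    by rewrite ler_wiXn2l // ltW.
  rewrite expr_sum; apply: ler_prod => i _; rewrite exprn_ge0 //= /F.
  by case: ifPn => // iu; have := n0 i; rewrite iu => /eqP ->.
apply: (@le_trans _ _ (\prod_i \sum_j F i j)).
  rewrite bigA_distr_bigA /= [leRHS](bigID (fun n => n \in G)) /= lerDl.
  by apply: sumr_ge0 => n _; apply: prodr_ge0.
rewrite -prodr_const [leRHS]big_mkcond /=; apply: ler_prod => i _.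
rewrite sumr_ge0 //= /F; case: ifP => iu; first exact: geom.
by rewrite (bigD1 ord0) //= big1 ?addr0 // => j /negPf ->.
Qed.

(** The exponent vectors that index brackets; the value 0 off [u] makes their number depend on
    [#|u|] instead of [d]. *)
Definition bounded_sum_keys (d S : nat) (u : {set 'I_d}) :
    {set {ffun 'I_d -> 'I_S.+1}} :=
  [set n : {ffun 'I_d -> 'I_S.+1} | (\sum_i n i <= S)%N
      && [forall i, (i \notin u) ==> (n i == ord0)]].

(** Take [x = 1 - 1 / (2 * 4^m)] in the generating function bound. Bernoulli gives [x^(4^m) >= 1/2],
    so with [k = #|u|] the count is at most [(2 * 4^m)^k * 4^k = 2^(k (3 + 2 m))]. *)
Lemma card_bounded_sum_keys_exp (R : realType) (d m : nat) (u : {set 'I_d}) :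
  #|bounded_sum_keys (2 * #|u| * 4 ^ m) u|%:R
    <= expR (#|u|%:R * (3 + 2 * m%:R)) :> R.
Proof.
set k := #|u|; set S := (2 * k * 4 ^ m)%N.
pose r : R := 4 ^+ m.
have r_ge1 : 1 <= r by rewrite exprn_ege1 // ler1n.
have r_gt0 : 0 < r by lra.
pose x : R := 1 - (2 * r)^-1.
have ri : 0 < (2 * r)^-1 by rewrite invr_gt0; lra.
have ri2 : (2 * r)^-1 <= 2^-1 by rewrite lef_pV2 ?posrE; lra.
have x01 : 0 <= x < 1 by apply/andP; rewrite /x; split; lra.
have := @card_bounded_sum_le R d S u x x01; rewrite -/(bounded_sum_keys _ _).
have -> : (1 - x)^-1 = 2 * r by rewrite /x opprB addrC subrK invrK.
rewrite -/k => h.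
have xr : 2^-1 <= x ^+ (4 ^ m).
  apply: le_trans (@expX_bernoulli R (- (2 * r)^-1) (4 ^ m) _); last by lra.
  have -> : (4 ^ m)%:R = r :> R by rewrite natrX.
  by rewrite invfM mulrN mulrCA mulfV ?gt_eqF //; lra.
have xS : (4^-1) ^+ k <= x ^+ S.
  have -> : S = ((4 ^ m) * 2 * k)%N by rewrite /S; lia.
  rewrite exprM [in leRHS]exprM lerXn2r ?nnegrE ?exprn_ge0 //; try lra.
  have -> : 4^-1 = 2^-1 ^+ 2 :> R by lra.
  by rewrite lerXn2r ?nnegrE ?invr_ge0 ?exprn_ge0 //; lra.
have E : expR 1 >= 2 :> R by have := expR_ge1Dx (1 : R); lra.
have hE : (8 * r) ^+ k <= expR (k%:R * (3 + 2 * m%:R)).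
  rewrite expRM_natl lerXn2r ?nnegrE ?expR_ge0 ?mulr_ge0 // ?(ltW r_gt0) //.
  have -> : 8 * r = 2 ^+ (3 + 2 * m) :> R.
    rewrite exprD exprM /r; congr (_ * _ ^+ _); lra.
  have -> : 3 + 2 * m%:R = (3 + 2 * m)%:R * 1 :> R by rewrite natrD natrM mulr1.
  by rewrite expRM_natl lerXn2r ?nnegrE ?expR_ge0.
apply: le_trans hE.
have -> : (8 * r) ^+ k = (2 * r) ^+ k * (4^-1 ^+ k)^-1.
  rewrite -exprVn invrK -exprMn; congr (_ ^+ _); lra.
rewrite ler_pdivlMr ?exprn_gt0 //.
by apply: le_trans h; rewrite ler_wpM2l.
Qed.

(** With [h = 1 / (2 k 2^m)], consecutive powers of [1 - h] differ by at most [h], and truncation to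
    the grid costs at most [1 / M <= h] more. Over [k] sides this adds up to [2 k h = 2^-m]. *)
Lemma grid_box_bracketing (R : realType) (d M m : nat) (u : {set 'I_d}) :
  (0 < #|u|)%N -> (2 * #|u| * 2 ^ m <= M)%N ->
  exists2 B, bracketing [set grid_box M u (fun i => a i) | a : {ffun 'I_d -> 'I_M.+1}]
               (2^-1 ^+ m : R) B
    & #|B|%:R <= expR (#|u|%:R * (3 + 2 * m%:R)) :> R.
Proof.
set k := #|u| => k_gt0; set H := (2 * k * 2 ^ m)%N => HM.
set S := (2 * k * 4 ^ m)%N.
have k_gt0R : 0 < k%:R :> R by rewrite ltr0n.
have H_gt0 : (0 < H)%N by rewrite !muln_gt0 k_gt0 expn_gt0.
have M_gt0 : (0 < M)%N by exact: leq_trans HM.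
have M_gt0R : 0 < M%:R :> R by rewrite ltr0n.
pose h : R := H%:R^-1.
have h_gt0 : 0 < h by rewrite invr_gt0 ltr0n.
have h_le1 : h <= 1 by rewrite invf_le1 ?ltr0n // ler1n.
pose rho := 1 - h.
have rho_ge0 : 0 <= rho by rewrite /rho; lra.
have rho_le1 : rho <= 1 by rewrite /rho; lra.
have rhoX_ge0 n : 0 <= rho ^+ n by rewrite exprn_ge0.
have rhoX_le1 n : rho ^+ n <= 1 by rewrite exprn_ile1.
have kh : 2 * k%:R * h = 2^-1 ^+ m.
  rewrite /h /H 2!natrM natrX invfM exprVn mulrA mulfV ?mul1r //.
  by rewrite gt_eqF ?mulr_gt0.
have Mh : M%:R^-1 <= h by rewrite lef_pV2 ?posrE ?ltr0n // ler_nat.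
(* The cut-off [S] is chosen so that [S h = 2^m >= m]. *)
have rhoS : rho ^+ S <= 2^-1 ^+ m.
  apply: le_trans (expRN_le_half_exp R m).
  apply: (@le_trans _ _ (expR (- h) ^+ S)).
    by rewrite lerXn2r ?nnegrE ?expR_ge0 //; have := expR_ge1Dx (- h); rewrite /rho.
  rewrite -expRM_natl ler_expR mulrN lerN2.
  have -> : S%:R * h = 2 ^+ m.
    have -> : S = (2 ^ m * H)%N by rewrite /S /H -[4%N]/(2 * 2)%N expnMn; lia.
    by rewrite natrM natrX /h mulfK // pnatr_eq0 -lt0n.
  by rewrite -natrX ler_nat ltnW // ltn_expl.
(* [tr n] is the side length [rho ^+ n] in grid units.  A box is sent to the
   exponents of its sides; if their sum reaches [S] the box has measure at most
   [rho ^+ S <= 2^-m], so the exponents are lowered to have sum [S] and the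
   lower bracket is empty. *)
pose tr n := Num.truncn (M%:R * rho ^+ n).
have tr_le n : (tr n)%:R / M%:R <= rho ^+ n.
  by rewrite ler_pdivrMr // [leRHS]mulrC truncn_le mulr_ge0.
have tr_ge n : rho ^+ n - h <= (tr n)%:R / M%:R.
  rewrite ler_pdivlMr //; have := truncnS_gt (M%:R * rho ^+ n).
  rewrite -/(tr n) -natr1.
  have : M%:R^-1 * M%:R <= h * M%:R by rewrite ler_wpM2r // ltW.
  by rewrite mulVf ?gt_eqF //; lra.
have tr_leM n : (tr n <= M)%N.
  rewrite -(ler_nat R); have := tr_le n; rewrite ler_pdivrMr // => /le_trans; apply.
  by rewrite -[leRHS]mul1r ler_wpM2r // ltW.
have tr_mono n n' : (n <= n')%N -> (tr n' <= tr n)%N.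
  by move=> nn'; apply: le_truncn; rewrite ler_wpM2l ?(ltW M_gt0R) // ler_wiXn2l.
pose U (n : {ffun 'I_d -> 'I_S.+1}) := grid_box M u (fun i => tr (n i)).
pose L (n : {ffun 'I_d -> 'I_S.+1}) :=
  if (\sum_i n i < S)%N then grid_box M u (fun i => tr (n i).+1) else finset.set0.
exists [set (L n, U n) | n in bounded_sum_keys S u]; last first.
  apply: le_trans (card_bounded_sum_keys_exp R m u).
  by rewrite ler_nat leq_imset_card.
have T_gt0 : (0 < #|{ffun 'I_d -> 'I_M}|)%N.
  by rewrite card_ffun !card_ord expn_gt0 M_gt0.
have T_gt0R : 0 < #|{ffun 'I_d -> 'I_M}|%:R :> R by rewrite ltr0n.
split=> [_ /imsetP[a _ ->]|_ /imsetP[n nG ->]] /=.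
  (* On [u], the largest exponent up to [S] whose power still dominates the side [a i]; the strict
     lower bound may fail when the exponent is capped at [S]. *)
  have [f f0 fu] : exists2 f : {ffun 'I_d -> 'I_S.+1},
      (forall i, i \notin u -> f i = ord0) & forall i, i \in u ->
      (a i)%:R <= M%:R * rho ^+ f i /\
      ((f i < S)%N -> M%:R * rho ^+ (f i).+1 < (a i)%:R).
    pose P i (n : 'I_S.+1) := (a i)%:R <= M%:R * rho ^+ n.
    exists [ffun i => if i \in u then [arg max_(n > ord0 | P i n) (n : nat)] else ord0].
      by move=> i /negPf iu; rewrite ffunE iu.
    move=> i iu; rewrite ffunE iu; case: arg_maxnP => [|n Pn nmax].
      by rewrite /P expr0 mulr1 ler_nat -ltnS.
    split=> // nS; rewrite ltNge; apply/negP => Pn1.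
    have := nmax (inord n.+1); rewrite /P inordK // => /(_ Pn1).
    by rewrite /geq /= ltnn.
  have aU (g : {ffun 'I_d -> 'I_S.+1}) : (forall i, (g i <= f i)%N) ->
      grid_box M u (fun i => a i) \subset U g.
    move=> gf; apply: grid_box_subset => i iu; have [ai _] := fu i iu.
    apply: leq_trans (tr_mono _ _ (gf i)).
    by rewrite truncn_ge_nat // mulr_ge0.
  have [fS|Sf] := ltnP (\sum_i f i)%N S.
    exists (L f, U f).
      apply/imsetP; exists f => //; rewrite inE (ltnW fS).
      by apply/forallP => i; apply/implyP => /f0 ->.
    rewrite /= aU // andbT /L fS; apply: grid_box_subset => i iu.
    have [_ ai] := fu i iu.
    (* A sum below [S] means that no exponent is capped. *)
    have /ai {}ai : (f i < S)%N.
      by apply: leq_ltn_trans fS; rewrite (bigD1 i) //= leq_addr.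
    rewrite -(ler_nat R); apply: le_trans (ltW ai).
    by rewrite truncn_le mulr_ge0.
  have [g gf gS] := exists_sum_eq Sf.
  pose g' : {ffun 'I_d -> 'I_S.+1} := [ffun i => inord (g i)].
  have g'E i : g' i = g i :> nat.
    by rewrite ffunE inordK // ltnS; apply: leq_trans (gf i) _; rewrite -ltnS.
  have g'S : (\sum_i g' i = S)%N by rewrite -[RHS]gS; apply: eq_bigr => i _; exact: g'E.
  exists (L g', U g').
    apply/imsetP; exists g' => //; rewrite inE g'S leqnn /=.
    apply/forallP => i; apply/implyP => /f0 fi; apply/eqP/val_inj => /=.
    by apply/eqP; rewrite g'E -leqn0; have := gf i; rewrite fi.
  rewrite /= /L g'S ltnn finset.sub0set /=; apply: aU => i; rewrite g'E; exact: gf.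
have UE : #|U n|%:R / #|{ffun 'I_d -> 'I_M}|%:R = \prod_(i in u) ((tr (n i))%:R / M%:R) :> R.
  by rewrite measure_grid_box.
move: nG; rewrite inE => /andP[nS /forallP n0].
rewrite -ler_pdivrMr // /L; case: ifPn => nS1.
  have LU : grid_box M u (fun i => tr (n i).+1) \subset U n.
    by apply: grid_box_subset => i _; apply: tr_mono.
  rewrite LU cardsD (finset.setIidPr LU) natrB ?subset_leq_card // mulrBl UE.
  rewrite measure_grid_box //=.
  have bounds i : i \in u -> [/\ 0 <= (tr (n i).+1)%:R / M%:R :> R,
      (tr (n i).+1)%:R / M%:R <= (tr (n i))%:R / M%:R :> R
      & (tr (n i))%:R / M%:R <= 1 :> R].
    move=> _; split; first by rewrite divr_ge0.
      by rewrite ler_pM2r ?invr_gt0 // ler_nat tr_mono.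
    by apply: le_trans (tr_le _) (rhoX_le1 _).
  have /andP[_ /le_trans] := prod_sub_bound bounds; apply.
  have step i : i \in u ->
      (tr (n i))%:R / M%:R - (tr (n i).+1)%:R / M%:R <= 2 * h :> R.
    move=> _; have := tr_le (n i); have := tr_ge (n i).+1.
    have : rho ^+ n i * h <= 1 * h by rewrite ler_wpM2r // ltW.
    by rewrite exprS /rho; lra.
  apply: le_trans (ler_sum _ step) _; rewrite sumr_const -/k -kh -[leLHS]mulr_natr.
  lra.
(* Here the exponents sum to exactly [S], so the upper end alone has measure at most [rho ^+ S]. *)
rewrite finset.sub0set finset.setD0 UE.
have rhoSE : rho ^+ S = \prod_i rho ^+ n i.
  rewrite -expr_sum; congr (_ ^+ _).
  by apply/eqP; rewrite eqn_leq leqNgt nS1 nS.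
apply: le_trans rhoS; rewrite rhoSE [leLHS]big_mkcond /=.
apply: ler_prod => i _; case: ifPn => iu.
  by rewrite divr_ge0 //= tr_le.
by have := n0 i; rewrite iu => /eqP ->; rewrite ler01 expr0 /=.
Qed.

(** * From the grid to the unit cube *)

Lemma lebesgue_tuple_set0 (R : realType) (d : nat) :
  lebesgue_tuple (set0 : set (d.-tuple R)) = 0%E.
Proof.
elim: d => [|d IH] /=; first by rewrite indicE in_set0.
rewrite (eq_integral (cst 0%E)) ?integral0 //.
Qed.

(** Induction on [d]: the section at [t] is the box of the remaining coordinates if [t] lies in the
    first side, and empty otherwise. *)
Lemma lebesgue_anchored_box (R : realType) (d : nat) (z : d.-tuple R) :
  (forall i, 0 <= tnth z i) ->
  lebesgue_tuple (anchored_box z) = (\prod_i tnth z i)%:E.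
Proof.
elim: d z => [|d IH] z z_ge0 /=.
  by rewrite big_ord0 indicE mem_set // => -[].
have [a [y zE]] : exists a, exists y : d.-tuple R, z = [tuple of a :: y].
  by case/tupleP: z z_ge0 => a y _; exists a, y.
have a_ge0 : 0 <= a by have := z_ge0 ord0; rewrite zE tnth0.
have y_ge0 i : 0 <= tnth y i by have := z_ge0 (lift ord0 i); rewrite zE tnthS.
pose D : set (measurableTypeR R) := `[0, a[%classic.
transitivity (\int[@lebesgue_measure R]_t
    (((cst (\prod_i tnth y i)%:E) \_ D) t))%E.
  apply: eq_integral => t _; rewrite patchE; case: ifPn => tD.
    rewrite -IH //; congr lebesgue_tuple; apply/seteqP; split=> s /=.
      by move=> h i; have := h (lift ord0 i); rewrite zE !tnthS.
    move: tD; rewrite inE /D /= in_itv /= => tD h i.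
    by case: (unliftP ord0 i) => [j ->|->]; rewrite zE ?tnthS ?tnth0.
  rewrite -[RHS](lebesgue_tuple_set0 R d); congr lebesgue_tuple.
  apply/seteqP; split=> s //= h; move/negP: tD; case.
  by rewrite inE /D /= in_itv /=; have := h ord0; rewrite zE !tnth0.
rewrite -integral_mkcond integral_cst; last exact: measurable_itv.
transitivity ((\prod_i tnth y i)%:E * a%:E)%E.
  congr (_ * _)%E; rewrite /D; apply: etrans (lebesgue_measure_itv _) _.
  rewrite /= lte_fin; case: ltP => [_|a_le0]; first by rewrite sube0.
  by have -> : a = 0 by apply/eqP; rewrite eq_le a_ge0 a_le0.
rewrite big_ord_recl zE tnth0 mulrC EFinM; congr (_%:E * _)%E.
by apply: eq_bigr => i _; rewrite tnthS.
Qed.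

Lemma set_deviation_le (R : realType) (T : finType) (N : nat)
    (w : {ffun 'I_N -> T}) (A : {set T}) :
  `|set_deviation R w A| <= N%:R.
Proof.
rewrite set_deviationE.
set X := \sum_n _; set p := _ / _.
have h1 : 0 <= X <= N%:R.
  rewrite sumr_ge0 //= /X -natr_sum ler_nat -[leqRHS]card_ord -sum1_card.
  by apply: leq_sum => n _; case: (_ \in A).
have h2 : 0 <= p <= 1.
  rewrite divr_ge0 //= /p; have [->|T_gt0] := posnP #|T|.
    by rewrite invr0 mulr0.
  by rewrite ler_pdivrMr ?ltr0n // mul1r ler_nat max_card.
have N_ge0 : 0 <= N%:R :> R by [].
rewrite ler_norml; case/andP: h1 => h1 h1'; case/andP: h2 => h2 h2'.
have h3 : N%:R * p <= N%:R * 1 by rewrite ler_wpM2l.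
have h4 : 0 <= N%:R * p by rewrite mulr_ge0.
by apply/andP; split; lra.
Qed.

(** For [t > sqrt N] the event is empty, as deviations never exceed [N]. Otherwise chaining applies,
    and [#|u| <= t^2] converts the bracket count into the one required there. *)
Lemma grid_box_tail (R : realType) (d M N : nat) (u : {set 'I_d}) (t : R) :
  (0 < N)%N -> (2 * d * N <= M)%N -> (0 < #|u|)%N ->
  0 <= t -> #|u|%:R <= t ^+ 2 ->
  #|[set w : {ffun 'I_N -> {ffun 'I_d -> 'I_M}} |
      [exists a : {ffun 'I_d -> 'I_M.+1}, 1282 * t * Num.sqrt N%:R
         < `|set_deviation R w (grid_box M u (fun i => a i))|]]|%:R
    <= 4 * expR (- t ^+ 2) * #|{ffun 'I_d -> 'I_M}|%:R ^+ N.
Proof.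
move=> N_gt0 dNM u_gt0 t_ge0 ut; pose T : finType := {ffun 'I_d -> 'I_M}.
set s := Num.sqrt N%:R.
have N_gt0R : 0 < N%:R :> R by rewrite ltr0n.
have s_gt0 : 0 < s by rewrite sqrtr_gt0.
have sE : s ^+ 2 = N%:R by rewrite sqr_sqrtr // ltW.
have t_ge1 : 1 <= t.
  rewrite -(@ler_pXn2r _ 2) ?nnegrE // expr1n; apply: le_trans ut.
  by rewrite ler1n.
have d_ge : (#|u| <= d)%N by rewrite -[leqRHS]card_ord max_card.
have [ts|st] := leP t s; last first.
  rewrite (_ : #|_| = 0)%N ?mulr_ge0 ?exprn_ge0 ?expR_ge0 //.
  apply: eq_card0 => w; rewrite inE; apply/negbTE; rewrite negb_exists.
  apply/forallP => a; rewrite -leNgt; apply: le_trans (set_deviation_le _ _ _) _.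
  rewrite -sE; have : s * s <= t * s by rewrite ler_wpM2r // ltW.
  have : 0 <= t * s by rewrite mulr_ge0 // ltW.
  by rewrite expr2; lra.
have s_leN : s <= N%:R.
  rewrite -sE ler_eXnr // -(@ler_pXn2r _ 2) ?nnegrE ?(ltW s_gt0) //.
  by rewrite expr1n sE ler1n.
have ex : exists n, s <= t * 2 ^+ n.+1.
  exists N; apply: le_trans s_leN _.
  apply: (@le_trans _ _ (1 * 2 ^+ N.+1)); last by rewrite ler_wpM2r.
  by rewrite mul1r -natrX ler_nat ltnW // ltnW // ltn_expl.
have [n sn tn] : exists2 n, s <= t * 2 ^+ n.+1 & t * 2 ^+ n <= s.
  case: (ex_minnP ex) => -[|n] sn nmin; first by exists 0%N => //; rewrite mulr1.
  exists n.+1 => //; rewrite leNgt; apply/negP => /ltW /nmin.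
  by rewrite ltnn.
(* The grid resolves all levels because [2^n <= t 2^n <= sqrt N <= N]. *)
have small m : (m <= n)%N -> (2 * #|u| * 2 ^ m <= M)%N.
  move=> mn; apply: leq_trans dNM; apply: leq_mul; first by rewrite leq_mul2l d_ge orbT.
  rewrite -(ler_nat R) natrX; apply: le_trans s_leN; apply: le_trans tn.
  rewrite -[leLHS]mul1r; apply: ler_pM => //.
  by rewrite ler_weXn2l //; lra.
have /choice[B hB] : forall m, exists B, (m <= n)%N ->
    bracketing [set grid_box M u (fun i => a i) | a : {ffun 'I_d -> 'I_M.+1}]
      (2^-1 ^+ m : R) B /\ #|B|%:R <= expR (t ^+ 2 * (3 + 2 * m%:R)).
  move=> m; have [mn|_] := boolP (m <= n)%N; last by exists finset.set0.
  have [B brB cardB] := @grid_box_bracketing R d M m u u_gt0 (small m mn).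
  exists B => _; split=> //; apply: le_trans cardB _.
  by rewrite ler_expR ler_wpM2r // addr_ge0 // mulr_ge0.
have M_gt0 : (0 < M)%N.
  by apply: leq_trans dNM; rewrite !muln_gt0 N_gt0 (leq_trans u_gt0 d_ge).
have T_gt0 : (0 < #|T|)%N by rewrite card_ffun !card_ord expn_gt0 M_gt0.
have := chaining N_gt0 T_gt0 t_ge1 tn sn
  (fun m mn => (hB m mn).1) (fun m mn => (hB m mn).2).
apply: le_trans; rewrite ler_nat; apply: subset_leq_card.
apply/fintype.subsetP => w; rewrite !inE => /existsP[a ha].
apply/existsP; exists (grid_box M u (fun i => a i)); rewrite ha andbT.
by apply/imsetP; exists a.
Qed.

Lemma exists_good_points (R : realType) (d M N : nat) (P : pred {set 'I_d})
    (t : {set 'I_d} -> R) :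
  (0 < N)%N -> (0 < d)%N -> (2 * d * N <= M)%N ->
  (forall u, P u -> [/\ (0 < #|u|)%N, 0 <= t u & #|u|%:R <= t u ^+ 2]) ->
  \sum_(u | P u) 4 * expR (- t u ^+ 2) < 1 ->
  exists w : {ffun 'I_N -> {ffun 'I_d -> 'I_M}}, forall u, P u ->
    forall a : {ffun 'I_d -> 'I_M.+1},
    `|set_deviation R w (grid_box M u (fun i => a i))|
      <= 1282 * t u * Num.sqrt N%:R.
Proof.
move=> N_gt0 d_gt0 dNM hP sum_lt1.
have M_gt0 : (0 < M)%N by apply: leq_trans dNM; rewrite !muln_gt0 N_gt0 d_gt0.
pose F u := [set w : {ffun 'I_N -> {ffun 'I_d -> 'I_M}} |
      [exists a : {ffun 'I_d -> 'I_M.+1}, 1282 * t u * Num.sqrt N%:R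
         < `|set_deviation R w (grid_box M u (fun i => a i))|]].
set K := #|{ffun 'I_d -> 'I_M}|%:R ^+ N : R.
have KE : #|{ffun 'I_N -> {ffun 'I_d -> 'I_M}}|%:R = K.
  by rewrite card_ffun card_ord natrX.
have K_gt0 : 0 < K by rewrite exprn_gt0 // ltr0n card_ffun !card_ord expn_gt0 M_gt0.
have : #|\bigcup_(u | P u) F u|%:R < K.
  apply: (@le_lt_trans _ _ (\sum_(u | P u) 4 * expR (- t u ^+ 2) * K)).
    apply: (@le_trans _ _ (\sum_(u | P u) #|F u|%:R)).
      by rewrite -natr_sum ler_nat card_bigcup_le.
    apply: ler_sum => u /hP[u_gt0 tu ut]; exact: grid_box_tail.
  by rewrite -mulr_suml -[ltRHS]mul1r ltr_pM2r.
rewrite -KE ltr_nat => hlt.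
have [w wF] : exists w, w \notin (\bigcup_(u | P u) F u)%SET.
  apply/existsP; rewrite -negb_forall; apply: contraTN hlt => /forallP h.
  by rewrite -leqNgt; apply/subset_leq_card/fintype.subsetP => w _; exact: h.
exists w => u Pu a; rewrite leNgt; apply: contra wF => ha.
apply/finset.bigcupP; exists u => //; rewrite inE.
by apply/existsP; exists a.
Qed.

Definition grid_points (R : realType) (d M N : nat)
    (w : {ffun 'I_N -> {ffun 'I_d -> 'I_M}}) : N.-tuple (d.-tuple R) :=
  [tuple [tuple (w n i)%:R / M%:R | i < d] | n < N].

Lemma grid_points_in_cube (R : realType) (d M N : nat)
    (w : {ffun 'I_N -> {ffun 'I_d -> 'I_M}}) :
  points_in_cube (grid_points R w).
Proof.
move=> n i; rewrite !tnth_mktuple divr_ge0 //=.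
have M_gt0 : (0 < M)%N by apply: leq_ltn_trans (ltn_ord (w n i)).
by rewrite ler_pdivrMr ?ltr0n // mul1r ler_nat ltnW.
Qed.

(** Rounding a side up to its ceiling in grid units keeps exactly the same grid points, because the
    boxes are half-open. *)
Lemma discrete_ceil (R : realType) (M : nat) (y : R) :
  0 <= y <= M%:R -> exists a : 'I_M.+1,
    [/\ forall j : nat, (j < a)%N = (j%:R < y), y <= a%:R & a%:R <= y + 1].
Proof.
case/andP=> y_ge0 yM; have ex : exists n : nat, y <= n%:R by exists M.
case: (ex_minnP ex) => a ya amin.
have aM : (a < M.+1)%N by rewrite ltnS amin.
exists (Ordinal aM); split=> //= [j|].
  apply/idP/idP => [ja|jy]; last by rewrite -(ltr_nat R); apply: lt_le_trans ya.
  by rewrite ltNge; apply/negP => /amin; rewrite leqNgt ja.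
case: a ya amin {aM} => [|a] ya amin; first by lra.
rewrite -natr1 lerD2r leNgt; apply/negP => /ltW/amin.
by rewrite ltnn.
Qed.

(** Rounding the box up to the grid preserves the point count and increases the volume by at most
    [#|u| / M <= 1 / N]. *)
Lemma discrepancy_grid_points (R : realType) (d M N : nat)
    (w : {ffun 'I_N -> {ffun 'I_d -> 'I_M}}) (u : {set 'I_d}) (z : d.-tuple R) :
  (0 < N)%N -> (0 < d)%N -> (d * N <= M)%N -> unit_cube z ->
  exists a : {ffun 'I_d -> 'I_M.+1},
    `|discrepancy (grid_points R w) (replace1 u z)|
      <= N%:R^-1 * `|set_deviation R w (grid_box M u (fun i => a i))| + N%:R^-1.
Proof.
move=> N_gt0 d_gt0 dNM zC.
have M_gt0 : (0 < M)%N by apply: leq_trans dNM; rewrite !muln_gt0 N_gt0 d_gt0.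
have M_gt0R : 0 < M%:R :> R by rewrite ltr0n.
have N_gt0R : 0 < N%:R :> R by rewrite ltr0n.
have zM i : 0 <= tnth z i * M%:R <= M%:R.
  have /andP[z0 z1] := zC i; rewrite mulr_ge0 //=.
  by rewrite -[leRHS]mul1r ler_wpM2r.
have /choice[a0 ha0] := fun i => @discrete_ceil R M _ (zM i).
pose a : {ffun 'I_d -> 'I_M.+1} := [ffun i => a0 i].
have ha i : [/\ forall j : nat, (j < a i)%N = (j%:R < tnth z i * M%:R),
    tnth z i * M%:R <= (a i)%:R & (a i)%:R <= tnth z i * M%:R + 1].
  by rewrite ffunE; exact: ha0.
exists a.
have indE n : \1_(anchored_box (replace1 u z)) (tnth (grid_points R w) n)
    = (w n \in grid_box M u (fun i => a i))%:R :> R.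
  rewrite indicE; congr (nat_of_bool _)%:R; apply/idP/idP.
    rewrite inE => h; rewrite inE; apply/forall_inP => i iu.
    have [-> _ _] := ha i; have := h i.
    by rewrite !tnth_mktuple iu => /andP[_]; rewrite ltr_pdivrMr.
  move=> hw; apply: mem_set => i; move: hw; rewrite inE => /forall_inP h.
  rewrite !tnth_mktuple divr_ge0 //=.
  rewrite ltr_pdivrMr //; case: ifP => iu.
    by have [h1 _ _] := ha i; rewrite -h1 h.
  (* Off [u] the side is 1, and grid coordinates are strictly below 1. *)
  by rewrite mul1r ltr_nat.
have rz_ge0 i : 0 <= tnth (replace1 u z) i.
  by rewrite tnth_mktuple; case: ifP => // _; have /andP[] := zC i.
have volE : fine (lebesgue_tuple (anchored_box (replace1 u z)))
    = \prod_(i in u) tnth z i.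
  rewrite lebesgue_anchored_box //= [RHS]big_mkcond; apply: eq_bigr => i _.
  by rewrite tnth_mktuple.
have bounds i : i \in u -> [/\ 0 <= tnth z i,
    tnth z i <= (a i)%:R / M%:R & (a i)%:R / M%:R <= 1 :> R].
  move=> _; have /andP[z_ge0 _] := zC i; have [_ h1 h2] := ha i; split=> //.
    by rewrite ler_pdivlMr.
  by rewrite ler_pdivrMr // mul1r ler_nat -ltnS.
have /andP[vol_ge vol_le] := prod_sub_bound bounds.
have step i : i \in u -> (a i)%:R / M%:R - tnth z i <= M%:R^-1.
  move=> _; have [_ _ h2] := ha i.
  by rewrite lerBlDr ler_pdivrMr // mulrDl mulVf ?gt_eqF // addrC.
have {}vol_le : \prod_(i in u) ((a i)%:R / M%:R) - \prod_(i in u) tnth z i <= N%:R^-1.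
  apply: le_trans vol_le _; apply: le_trans (ler_sum _ step) _.
  rewrite sumr_const -[leLHS]mulr_natl ler_pdivrMr // mulrC ler_pdivlMr // -natrM ler_nat.
  apply: leq_trans dNM; rewrite leq_mul2r; apply/orP; right.
  by apply: leq_trans (max_card _) _; rewrite card_ord.
rewrite /discrepancy volE (eq_bigr _ (fun n _ => indE n)).
rewrite set_deviationE measure_grid_box //; last first.
  by move=> i _; rewrite -ltnS.
set X := \sum_n _; set V := \prod_(i in u) tnth z i in vol_ge vol_le *.
set W := \prod_(i in u) _ in vol_ge vol_le *.
have -> : N%:R^-1 * X - V = N%:R^-1 * (X - N%:R * W) + (W - V).
  by rewrite mulrBr mulKf ?gt_eqF //; ring.
apply: le_trans (ler_normD _ _) _; apply: lerD; last by rewrite ger0_norm.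
by rewrite normrM ger0_norm // invr_ge0 ltW.
Qed.

(** * Summation over the weights *)

Lemma sum_le_esum (R : realType) (T : choiceType) (I : finType) (P : pred I)
    (h : I -> T) (A : set T) (a : T -> R) :
  injective h -> (forall i, P i -> A (h i)) ->
  ((\sum_(i | P i) a (h i))%:E <= \esum_(t in A) (a t)%:E)%E.
Proof.
move=> h_inj hA; apply: esum_ge.
exists [set` [seq h i | i <- enum P]]%classic.
  split; first exact: finite_seq.
  by move=> t /= /mapP[i]; rewrite mem_enum => Pi ->; apply: hA.
rewrite -fsbig_seq; last by rewrite map_inj_uniq // enum_uniq.
rewrite big_map big_enum_cond /= sumEFin lee_fin le_eqVlt; apply/orP; left.
by apply/eqP; apply: eq_bigl => i; rewrite andbT.
Qed.

Lemma fset_of_coords_inj (d : nat) : injective (@fset_of_coords d).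
Proof.
have memE (u : {set 'I_d}) (i : 'I_d) : (val i \in fset_of_coords u) = (i \in u).
  apply/imfsetP/idP => /= [[j ju /val_inj ->]//|iu]; by exists i.
by move=> u v uv; apply/setP => i; rewrite -!memE uv.
Qed.

Lemma card_fset_of_coords (d : nat) (u : {set 'I_d}) :
  #|` fset_of_coords u| = #|u|.
Proof. by rewrite /fset_of_coords card_imfset //= -?cardE //; exact: val_inj. Qed.

(** With [t = B / gamma u] the weighted deviation bound [1282 B / sqrt N] is the same for every [u];
    the rounding error adds at most [gamma u / N <= c / sqrt N]. *)
Lemma exists_low_discrepancy (R : realType) (gamma : {fset nat} -> R)
  (gamma_ge0 : forall u : {fset nat}, u != fset0 -> 0 <= gamma u)
  (c : R) (c_gt0 : 0 < c)
  (gamma_le : forall u : {fset nat}, u != fset0 ->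
     gamma u <= c * (#|` u|%:R) `^ (- 2^-1))
  (gamma_sum : (\esum_(u in [set u : {fset nat} | u != fset0]%classic)
                  (exp_inv_sq c (gamma u))%:E < +oo)%E) :
  exists C : R, forall N d : nat, (1 <= N)%N -> (1 <= d)%N ->
     exists x : N.-tuple (d.-tuple R), points_in_cube x /\
       (weighted_star_discrepancy gamma x <= (C / Num.sqrt N%:R)%:E)%E.
Proof.
pose E := (\esum_(u in [set u : {fset nat} | u != fset0]%classic)
                  (exp_inv_sq c (gamma u))%:E)%E.
have exp_ge0 g : 0 <= exp_inv_sq c g by rewrite /exp_inv_sq; case: ifP => // _; exact: expR_ge0.
have E_ge0 : (0 <= E)%E by apply: esum_ge0 => u _; rewrite lee_fin.
pose S := fine E.
have ES : E = S%:E by rewrite fineK // ge0_fin_numE.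
have S_ge0 : 0 <= S by rewrite fine_ge0.
(* [B >= c] gives [#|u| <= t^2]. As [B >= 1], also [B^2 >= c + 4 S c^2]; with [g u <= c] this gains
   a factor [expR (- 4 S)] on each summand, and the total is at most [4 S expR (- 4 S) < 1]. *)
pose B := 1 + c + 4 * S * c ^+ 2.
have Sc_ge0 : 0 <= S * c ^+ 2 by rewrite mulr_ge0 ?sqr_ge0.
have B_ge1 : 1 <= B by rewrite /B; lra.
have B_sq : c + 4 * S * c ^+ 2 <= B ^+ 2.
  have : B * 1 <= B * B by rewrite ler_wpM2l //; lra.
  by rewrite expr2 {1}/B; lra.
have Bc : c <= B by rewrite /B; lra.
clearbody B.
exists (1282 * B + c) => N d N_gt0 d_gt0.
pose g (u : {set 'I_d}) := gamma (fset_of_coords u).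
have fset_neq0 (u : {set 'I_d}) : (0 < #|u|)%N -> fset_of_coords u != fset0.
  by rewrite -cardfs_gt0 card_fset_of_coords.
have g_ge0 (u : {set 'I_d}) : (0 < #|u|)%N -> 0 <= g u by move=> /fset_neq0; exact: gamma_ge0.
have g_le (u : {set 'I_d}) : (0 < #|u|)%N -> g u ^+ 2 * #|u|%:R <= c ^+ 2.
  move=> u_gt0; have u_gt0R : 0 < #|u|%:R :> R by rewrite ltr0n.
  have := gamma_le _ (fset_neq0 u u_gt0).
  rewrite card_fset_of_coords powRN powR12_sqrt // -/(g u).
  rewrite ler_pdivlMr ?sqrtr_gt0 // => h.
  have : (g u * Num.sqrt #|u|%:R) ^+ 2 <= c ^+ 2.
    by rewrite lerXn2r ?nnegrE ?mulr_ge0 ?g_ge0 ?sqrtr_ge0 // ltW.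
  by rewrite exprMn sqr_sqrtr // ltW.
have g_lec (u : {set 'I_d}) : (0 < #|u|)%N -> g u <= c.
  move=> u_gt0; rewrite -(@ler_pXn2r _ 2) ?nnegrE ?g_ge0 ?(ltW c_gt0) //.
  apply: le_trans (g_le u u_gt0); rewrite -[leLHS]mulr1.
  by rewrite ler_wpM2l ?sqr_ge0 // ler1n.
(* Zero weights are set aside: they contribute nothing to the discrepancy, and [B / 0] is 0 by
   convention. *)
pose P (u : {set 'I_d}) := (0 < #|u|)%N && (0 < g u).
have hP u : P u -> [/\ (0 < #|u|)%N, 0 <= B / g u & #|u|%:R <= (B / g u) ^+ 2].
  case/andP=> u_gt0 gu_gt0; split=> //; first by rewrite divr_ge0 //; lra.
  rewrite expr_div_n ler_pdivlMr ?exprn_gt0 // mulrC.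
  by apply: le_trans (g_le u u_gt0) _; rewrite lerXn2r ?nnegrE //; lra.
have sum_lt1 : \sum_(u | P u) 4 * expR (- (B / g u) ^+ 2) < 1.
  have term u : P u -> 4 * expR (- (B / g u) ^+ 2)
      <= 4 * expR (- (4 * S)) * exp_inv_sq c (g u).
    case/andP=> u_gt0 gu_gt0; rewrite /exp_inv_sq gt_eqF // -mulrA ler_wpM2l //.
    rewrite -expRD ler_expR -opprD lerN2 expr_div_n.
    have g2_gt0 : 0 < g u ^+ 2 by rewrite exprn_gt0.
    rewrite ler_pdivlMr //.
    have -> : (4 * S + c * g u ^- 2) * g u ^+ 2 = 4 * S * g u ^+ 2 + c.
      by field; rewrite gt_eqF.
    have : 4 * S * g u ^+ 2 <= 4 * S * c ^+ 2.
      rewrite ler_wpM2l ?mulr_ge0 // lerXn2r ?nnegrE ?g_ge0 ?g_lec //; lra.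
    by lra.
  apply: le_lt_trans (ler_sum _ term) _; rewrite -mulr_sumr.
  have sumS : \sum_(u | P u) exp_inv_sq c (g u) <= S.
    rewrite -lee_fin -ES; apply: sum_le_esum; first exact: fset_of_coords_inj.
    by move=> u /andP[u_gt0 _] /=; exact: fset_neq0.
  have S4 : 4 * S * expR (- (4 * S)) < 1.
    rewrite expRN ltr_pdivrMr ?expR_gt0 // mul1r.
    by have := expR_ge1Dx (4 * S); lra.
  have : 0 <= 4 * expR (- (4 * S)) by rewrite mulr_ge0 ?expR_ge0.
  by move=> h0; have := ler_wpM2l h0 sumS; lra.
have [w hw] := exists_good_points N_gt0 d_gt0 (leqnn (2 * d * N)) hP sum_lt1.
exists (grid_points R w); split; first exact: grid_points_in_cube.
have N_gt0R : 0 < N%:R :> R by rewrite ltr0n.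
set s := Num.sqrt N%:R; have s_gt0 : 0 < s by rewrite sqrtr_gt0.
have sE : N%:R = s ^+ 2 by rewrite sqr_sqrtr // ltW.
have s_ge1 : 1 <= s.
  by rewrite -(@ler_pXn2r _ 2) ?nnegrE ?(ltW s_gt0) // expr1n -sE ler1n.
(* Covers the starting value 0 of the maximum. *)
have bound_ge0 : 0 <= (1282 * B + c) / s by apply: divr_ge0; [lra | exact: ltW].
apply: ge_ereal_sup => _ [z zC <-]; rewrite lee_fin.
elim/big_ind: _ => // [x y hx hy|u u_gt0]; first by rewrite ge_max hx hy.
rewrite -/(g u).
have dNM : (d * N <= 2 * d * N)%N by rewrite -mulnA leq_pmull.
have [a ha] := discrepancy_grid_points w u N_gt0 d_gt0 dNM zC.
have [g0|g_neq0] := eqVneq (g u) 0; first by rewrite g0 mul0r.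
have gu_gt0 : 0 < g u by rewrite lt_neqAle eq_sym g_neq0 g_ge0.
have Pu : P u by rewrite /P u_gt0.
have := hw u Pu a; set D := `|set_deviation _ _ _| in ha *; rewrite -/s => hD.
apply: le_trans (ler_wpM2l (ltW gu_gt0) ha) _.
rewrite ler_pdivlMr // mulrDr mulrDl sE.
have -> : g u * (s ^+ 2)^-1 * s = g u / s by field; rewrite gt_eqF.
have -> : g u * ((s ^+ 2)^-1 * D) * s = g u * D / s by field; rewrite gt_eqF.
apply: lerD.
  rewrite ler_pdivrMr //.
  have := ler_wpM2l (ltW gu_gt0) hD.
  by have -> : g u * (1282 * (B / g u) * s) = 1282 * B * s by field.
rewrite ler_pdivrMr //; apply: le_trans (g_lec u u_gt0) _.
by rewrite -[leLHS]mulr1 ler_wpM2l // ltW.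
Qed.

(** * Strong tractability *)

Lemma tractability_bound_sqr (R : realType) (gamma : {fset nat} -> R) (C : R) :
  (forall N d : nat, (1 <= N)%N -> (1 <= d)%N ->
     exists x : N.-tuple (d.-tuple R), points_in_cube x /\
       (weighted_star_discrepancy gamma x <= (C / Num.sqrt N%:R)%:E)%E) ->
  tractability_bound gamma (C ^+ 2 + 1) 2.
Proof.
move=> hC d eps d_gt0 /andP[eps_gt0 eps_lt1].
have e2_gt0 : 0 < eps ^+ 2 by rewrite exprn_gt0.
have y_ge0 : 0 <= C ^+ 2 / eps ^+ 2 by rewrite divr_ge0 ?sqr_ge0.
(* Large enough for [|C| / sqrt N <= eps], and positive even if [C = 0]; the extra 1 is absorbed by
   [1 <= eps^-2]. *)
pose N := (Num.truncn (C ^+ 2 / eps ^+ 2)).+1.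
have N_gt : C ^+ 2 / eps ^+ 2 <= N%:R by rewrite ltW // truncnS_gt.
have N_le : N%:R <= C ^+ 2 / eps ^+ 2 + 1.
  by rewrite /N -natr1 lerD2r truncn_le.
have [x [xC xD]] := hC N d isT d_gt0.
have N_gt0R : 0 < N%:R :> R by rewrite ltr0n.
have s_gt0 : 0 < Num.sqrt N%:R :> R by rewrite sqrtr_gt0.
apply: (@le_trans _ _ N%:R%:E).
  apply: ereal_inf_lbound; exists N => //; split=> //; exists x; split=> //.
  apply: le_trans xD _; rewrite lee_fin ler_pdivrMr //.
  apply: le_trans (ler_norm _) _.
  rewrite -(@ler_pXn2r _ 2) ?nnegrE ?mulr_ge0 ?(ltW eps_gt0) ?(ltW s_gt0) //.
  rewrite real_normK ?num_real // exprMn sqr_sqrtr ?(ltW N_gt0R) //.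
  by rewrite mulrC -ler_pdivrMr.
rewrite lee_fin powRN powR_mulrn ?(ltW eps_gt0) //.
rewrite ler_pdivlMr // mulrC; apply: le_trans (ler_wpM2l (ltW e2_gt0) N_le) _.
rewrite mulrDr mulrCA mulfV ?gt_eqF // !mulr1 lerD2l.
by rewrite exprn_ile1 // ltW.
Qed.

Local Open Scope classical_set_scope.

Theorem theorem2 (R : realType) (gamma : {fset nat} -> R)
  (gamma_ge0 : forall u : {fset nat}, u != fset0 -> 0 <= gamma u)
  (c : R) (c_gt0 : 0 < c)
  (gamma_le : forall u : {fset nat}, u != fset0 ->
     gamma u <= c * (#|` u|%:R) `^ (- 2^-1))
  (gamma_sum : (\esum_(u in [set u : {fset nat} | u != fset0])
                  (exp_inv_sq c (gamma u))%:E < +oo)%E) :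
  (exists C : R, forall N d : nat, (1 <= N)%N -> (1 <= d)%N ->
     exists x : N.-tuple (d.-tuple R), points_in_cube x /\
       (weighted_star_discrepancy gamma x <= (C / Num.sqrt N%:R)%:E)%E) /\
  (strongly_tractable gamma /\ strong_tractability_exponent gamma <= 2).
Proof.
have [C hC] := exists_low_discrepancy gamma_ge0 c_gt0 gamma_le gamma_sum.
have C2_ge0 : 0 <= C ^+ 2 + 1 by rewrite addr_ge0 ?sqr_ge0.
have bound := tractability_bound_sqr hC.
split; [by exists C | split; first by exists (C ^+ 2 + 1), 2].
(* The exponents are bounded below by 0, so [inf] is a true infimum, and 2 is one of them. *)
apply: ge_inf; first by exists 0 => beta [].
by split=> //; exists (C ^+ 2 + 1).
Qed.
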